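(* Let $G\subset GL(4,\mathbb{Z}[i])$ be the group generated by the matrices $T_0,\dots,T_4$ defined in the context. Any $G$-invariant Hermitian $4\times4$ matrix with coefficients in $\mathbb{Z}[i]$ has the following shape, where $a\in\mathbb{Z}$: $$H_a:=a\begin{pmatrix}2&0&1&1+i\\0&2&1+i&-i\\1&1-i&2&0\\1-i&i&0&2\end{pmatrix}.$$
   Context: Let $$T_0=\begin{pmatrix}1&0&0&0\\0&-1&0&0\\0&-1+i&1&0\\1-i&0&0&-1\end{pmatrix},\quad N_5=\begin{pmatrix}1&-1&0&-i\\-i&0&i&i\\-i&-1&1+i&0\\1&-1+i&0&-1-i\end{pmatrix},$$ and $T_j=N_5^jT_0N_5^{-j}$ for $j=0,1,\dots,4$. The group $G$ generated by $T_0,\dots,T_4$ has order $32$ and is isomorphic to $Q_8\times_{\mathbb{Z}_2}D_8$. A Hermitian matrix $H$ is called $G$-invariant if $T\,H\,\overline{T}^{\,t}=H$ for all $T\in G$ (equivalently, for $T=T_0,\dots,T_4$). *)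

(* Defs.v *)
From HB Require Import structures.
From mathcomp Require Import all_boot all_order all_algebra all_field.

Set Implicit Arguments.
Unset Strict Implicit.
Unset Printing Implicit Defensive.

Import Order.TTheory GRing.Theory Num.Theory.
Local Open Scope ring_scope.
Local Open Scope sesquilinear_scope.

(* The ring Z[i], as a subset of the field algC of algebraic complex numbers. *)
Definition gaussInt : {pred algC} :=
  [pred z | ('Re z \in Num.int) && ('Im z \in Num.int)].

Definition mx4 (rows : seq (seq algC)) : 'M[algC]_4 :=
  \matrix_(i < 4, j < 4) nth 0 (nth [::] rows i) j.

Definition T0 : 'M[algC]_4 := mx4
  [:: [:: 1;      0;        0;  0];
      [:: 0;      -1;       0;  0];
      [:: 0;      -1 + 'i;  1;  0];
      [:: 1 - 'i; 0;        0;  -1]].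

Definition N5 : 'M[algC]_4 := mx4
  [:: [:: 1;    -1;       0;       - 'i];
      [:: - 'i; 0;        'i;      'i];
      [:: - 'i; -1;       1 + 'i;  0];
      [:: 1;    -1 + 'i;  0;       -1 - 'i]].

Definition T (j : nat) : 'M[algC]_4 := N5 ^+ j * T0 * N5 ^- j.

(* S is meant to consist of invertible matrices: on a singular matrix the     *)
(* library's inverse is the identity function.                                *)
Inductive generated (S : 'M[algC]_4 -> Prop) : 'M[algC]_4 -> Prop :=
| generated_gen A : S A -> generated S A
| generated_one : generated S 1
| generated_mul A B : generated S A -> generated S B -> generated S (A * B)
| generated_inv A : generated S A -> generated S A^-1.

Definition G : 'M[algC]_4 -> Prop :=
  generated (fun A => exists2 j : nat, (j <= 4)%N & A = T j).

Definition G_invariant (H : 'M[algC]_4) : Prop :=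
  forall A : 'M[algC]_4, G A -> A *m H *m A ^t* = H.

Definition Ha (a : int) : 'M[algC]_4 := a%:~R *: mx4
  [:: [:: 2;      0;       1;       1 + 'i];
      [:: 0;      2;       1 + 'i;  - 'i];
      [:: 1;      1 - 'i;  2;       0];
      [:: 1 - 'i; 'i;      0;       2]].

(* Main.v *)
(** Each T_j is conjugate to the involution T_0, hence is an involution, so
    invariance of H under T_j is equivalent to T_j H = H T_j^*, which is linear
    in the entries of H with few terms. The generators T_0, ..., T_3 already
    determine H up to a complex scalar, the entry x = H_02. Finally H_20 = x as
    well, so x is real because H is Hermitian, and a real Gaussian integer is an
    integer. *)
Require Import Defs.
From mathcomp Require Import all_boot all_order all_algebra all_field.
From mathcomp Require Import ring.

Set Implicit Arguments.
Unset Strict Implicit.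
Unset Printing Implicit Defensive.

Import Order.TTheory GRing.Theory Num.Theory.
Local Open Scope ring_scope.
Local Open Scope sesquilinear_scope.

(** This is the reduction rule handed to [ring] and [field], which then compute modulo the minimal
    polynomial of ['i]. *)
Lemma mulCii : 'i * 'i = -1 :> algC.
Proof. by rewrite -expr2 sqrCi. Qed.

Lemma sum_ord4 (R : nmodType) (F : 'I_4 -> R) :
  \sum_k F k = F (inord 0) + F (inord 1) + F (inord 2) + F (inord 3).
Proof.
rewrite !big_ord_recl big_ord0 addr0 !addrA.
by congr (F _ + F _ + F _ + F _); apply/val_inj; rewrite /= inordK.
Qed.

(** Indexing by naturals through [inord] lets a case analysis yield literal indices, which [mx4E]
    turns into list lookups. *)
Lemma mx4P (A B : 'M[algC]_4) :
  (forall i j, (i < 4)%N -> (j < 4)%N ->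
     A (inord i) (inord j) = B (inord i) (inord j)) -> A = B.
Proof.
by move=> eqAB; apply/matrixP=> i j; rewrite -[i]inord_val -[j]inord_val eqAB.
Qed.

Lemma mx4E rows i j : (i < 4)%N -> (j < 4)%N ->
  mx4 rows (inord i) (inord j) = nth 0 (nth [::] rows i) j.
Proof. by move=> lti ltj; rewrite mxE !inordK. Qed.

Lemma mx4_1 : 1%:M = mx4
  [:: [:: 1; 0; 0; 0]; [:: 0; 1; 0; 0]; [:: 0; 0; 1; 0]; [:: 0; 0; 0; 1]].
Proof.
apply: mx4P => i j lti ltj; rewrite mx4E // mxE -val_eqE /= !inordK //.
by move: i j lti ltj; do 4?[case=> [|]] => //; do 4?[case=> [|]].
Qed.

Lemma mulmx4E (A B : 'M[algC]_4) i j :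
  (A *m B) i j = A i (inord 0) * B (inord 0) j + A i (inord 1) * B (inord 1) j +
                 A i (inord 2) * B (inord 2) j + A i (inord 3) * B (inord 3) j.
Proof. by rewrite mxE sum_ord4. Qed.

Ltac mx4_ring :=
  apply: mx4P => [[|[|[|[|//]]]]] [|[|[|[|//]]]] _ _;
  rewrite !mulmx4E !mx4E //=; ring: mulCii.

(** The inverse of [N5], given explicitly to certify invertibility. *)
Definition N5V : 'M[algC]_4 := mx4
  [:: [:: 1 + 'i; 0;        0;   - 'i];
      [:: 0;      - 1 - 'i; 'i;  - 'i];
      [:: 'i;     -1;       1;   - 'i];
      [:: 1;      1 - 'i;   -1;  0]].

Lemma N5_unit : N5 \is a GRing.unit.
Proof.
suff: N5 *m N5V = 1%:M by case/mulmx1_unit.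
rewrite mx4_1; mx4_ring.
Qed.

Lemma T_succ j : T j.+1 = N5 * T j / N5.
Proof. by rewrite /T -!exprVn exprS exprSr !mulrA. Qed.

Lemma T_0 : T 0 = T0.
Proof. by rewrite /T expr0 invr1 mul1r mulr1. Qed.

Lemma T_sqr j : T j * T j = 1.
Proof.
elim: j => [|j IHj]; first by rewrite T_0 -mulmxE -idmxE mx4_1; mx4_ring.
rewrite T_succ; move: (T j) IHj => A AA.
by rewrite !mulrA (mulrVK N5_unit) -(mulrA N5) AA mulr1 divrr ?N5_unit.
Qed.

(** Clearing the denominator [N5] leaves a polynomial identity between explicit matrices, so each
    power of [N5] need not be inverted. *)
Lemma T_succ_eq j (A B : 'M[algC]_4) : T j = A -> N5 *m A = B *m N5 -> T j.+1 = B.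
Proof. by move=> <- eqN; rewrite T_succ -mulmxE eqN mulmxE (mulrK N5_unit). Qed.

Lemma T_1 : T 1 = mx4
  [:: [:: 1; 0;  0;      - 1 - 'i];
      [:: 0; -1; 1 + 'i; 0];
      [:: 0; 0;  1;      0];
      [:: 0; 0;  0;      -1]].
Proof. apply: T_succ_eq T_0 _; mx4_ring. Qed.

Lemma T_2 : T 2 = mx4
  [:: [:: 1;        -1 + 'i; 0;       - 1 - 'i];
      [:: - 1 - 'i; -1;      1 + 'i;  0];
      [:: 0;        -1 + 'i; 1;       - 1 - 'i];
      [:: 1 - 'i;   0;       -1 + 'i; -1]].
Proof. apply: T_succ_eq T_1 _; mx4_ring. Qed.

Lemma T_3 : T 3 = mx4
  [:: [:: 'i;     0;        0;       1 - 'i];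
      [:: 1 - 'i; - 'i;     -1 + 'i; 0];
      [:: 0;      - 1 - 'i; 'i;      1 - 'i];
      [:: 1 + 'i; 0;        0;       - 'i]].
Proof. apply: T_succ_eq T_2 _; mx4_ring. Qed.

Lemma involutive_invariant (A H : 'M[algC]_4) :
  A *m A = 1%:M -> A *m H *m A^t* = H -> A *m H = H *m A^t*.
Proof. by move=> AA H_inv; rewrite -{1}H_inv !mulmxA AA mul1mx. Qed.

Lemma T_invariant H j (A : 'M[algC]_4) :
  G_invariant H -> (j <= 4)%N -> T j = A -> A *m H = H *m A^t*.
Proof.
move=> H_inv lej TA; apply: involutive_invariant.
  by rewrite -TA mulmxE T_sqr.
by apply: H_inv; rewrite -TA; apply: generated_gen; exists j.
Qed.

Definition entry (A : 'M[algC]_4) m n := A (inord m) (inord n).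

(** Gives one scalar linear equation in the entries of [H], whose coefficients are read from rows
    [m] and [n] of the generator. *)
Lemma mx4_invariantE (rows : seq (seq algC)) H m n :
    mx4 rows *m H = H *m (mx4 rows)^t* -> (m < 4)%N -> (n < 4)%N ->
  let t := nth 0 (nth [::] rows m) in
  let t' k := (nth 0 (nth [::] rows n) k)^* in
  t 0 * entry H 0 n + t 1 * entry H 1 n + t 2 * entry H 2 n + t 3 * entry H 3 n =
  entry H m 0 * t' 0 + entry H m 1 * t' 1 + entry H m 2 * t' 2 + entry H m 3 * t' 3.
Proof.
move=> /matrixP/(_ (inord m) (inord n)) eqH ltm ltn; move: eqH.
have conjE k : (k < 4)%N -> (mx4 rows)^t* (inord k) (inord n) =
    (nth 0 (nth [::] rows n) k)^*.
  by move=> ltk; rewrite 2![in LHS]mxE mx4E.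
by rewrite !mulmx4E !conjE // !mx4E.
Qed.

(** The multiplier [c] certifies that the goal follows from a known equation; what remains is a
    field identity. *)
Lemma eq_lincomb (c x y l r : algC) : l = r -> x - y = c * (l - r) -> x = y.
Proof. by move=> -> /eqP; rewrite subrr mulr0 subr_eq0 => /eqP. Qed.

Ltac from c e :=
  apply: (eq_lincomb (c := c)) (e isT isT) _;
  rewrite /= ?(rmorphD, rmorphB, rmorphN, rmorph1, rmorph0) /= ?conjCi.

Theorem proposition4p1 (H : 'M[algC]_4)
  (H_gauss : H \is a mxOver gaussInt)
  (H_herm : H \is hermsymmx)
  (H_inv : G_invariant H) :
  exists a : int, H = Ha a.
Proof.
have E0 m n := mx4_invariantE (m := m) (n := n) (@T_invariant H 0 _ H_inv isT T_0).
have E1 m n := mx4_invariantE (m := m) (n := n) (@T_invariant H 1 _ H_inv isT T_1).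
have E2 m n := mx4_invariantE (m := m) (n := n) (@T_invariant H 2 _ H_inv isT T_2).
have E3 m n := mx4_invariantE (m := m) (n := n) (@T_invariant H 3 _ H_inv isT T_3).
set h := entry H in E0 E1 E2 E3; set x := h 0 2.
(* Here and below, the multiplier is the inverse of the coefficient, in left side minus right side,
   of the entry being solved for, once known entries are substituted. *)
have h01 : h 0 1 = 0 by from (2^-1 : algC) (E0 0 1); field: mulCii.
have h10 : h 1 0 = 0 by from (- 2^-1 : algC) (E0 1 0); field: mulCii.
have h03 : h 0 3 = (1 + 'i) / 2 * h 0 0.
  by from (2^-1 : algC) (E0 0 3); field: mulCii.
have h30 : h 3 0 = (1 - 'i) / 2 * h 0 0.
  by from (- 2^-1 : algC) (E0 3 0); field: mulCii.
have h12 : h 1 2 = (1 + 'i) / 2 * h 1 1.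
  by from (- 2^-1 : algC) (E0 1 2); field: mulCii.
have h21 : h 2 1 = (1 - 'i) / 2 * h 1 1.
  by from (2^-1 : algC) (E0 2 1); field: mulCii.
have h23 : h 2 3 = 0 by from (2^-1 : algC) (E1 2 3); field: mulCii.
have h32 : h 3 2 = 0 by from (- 2^-1 : algC) (E1 3 2); field: mulCii.
have h33 : h 3 3 = h 0 0.
  by from (- (1 - 'i) / 2 : algC) (E1 0 3); rewrite h03; field: mulCii.
have h22 : h 2 2 = h 1 1.
  by from ((1 - 'i) / 2 : algC) (E1 1 2); rewrite h12; field: mulCii.
have h31 : h 3 1 = 'i * x.
  by from (- (1 - 'i) / 2 : algC) (E1 0 1); rewrite h01 -/x; field: mulCii.
have h13 : h 1 3 = - 'i * h 2 0.
  by from ((1 + 'i) / 2 : algC) (E1 1 0); rewrite h10; field: mulCii.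
have h11 : h 1 1 = h 0 0.
  (* The two terms in [x] cancel, since [- (1 + 'i) * 'i = 1 - 'i]. *)
  by from (- (1 + 'i) / 2 : algC) (E2 0 1); rewrite h01 h31 -/x; field: mulCii.
have h00 : h 0 0 = 2 * x.
  by from (- (1 - 'i) / 2 : algC) (E3 0 1); rewrite h01 h31 -/x; field: mulCii.
have h20 : h 2 0 = x.
  by from (- (1 + 'i) / 4 : algC) (E3 1 0); rewrite h10 h13 h00; field: mulCii.
have x_real : x \is Num.real.
  (* The sign in the Hermitian condition is a zeroth power of -1. Its entry (0, 2) then reads [x] as
     the conjugate of [h 2 0], which is [x]. *)
  have /is_hermitianmxP := H_herm; rewrite expr0 scale1r.
  move=> /matrixP/(_ (inord 0) (inord 2)); rewrite 2![in RHS]mxE -/(entry H 2 0).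
  by rewrite -/(entry H 0 2) -/h h20 => xE; apply/CrealP; rewrite -xE.
have /mxOverP/(_ (inord 0) (inord 2))/andP[] := H_gauss.
rewrite -/(entry H 0 2) -/h -/x (Creal_ReP _ x_real) => /intrP[a xE] _.
exists a; apply: mx4P => i j lti ltj.
rewrite [RHS]mxE mx4E // -xE -/(entry H i j) -/h.
move: i j lti ltj => [|[|[|[|//]]]] [|[|[|[|//]]]] _ _ /=;
  (* Entries reduce first to [h 0 0], [h 1 1] and [x], and only then to [x] alone. *)
  rewrite ?(h01, h10, h23, h32) ?(h03, h30, h12, h21, h33, h22, h31, h13, h20);
  rewrite ?h11 ?h00 -/x; by field: mulCii.
Qed.
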